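(* Assume that $H$ is a Gorenstein ring. For an object $V\in\mathrm{Rep}^\infty_k(G)$ the following are equivalent. (i) $V$ is cofibrant in the $I$-Gorenstein projective model structure. (ii) $V$ is generated by its $I$-invariants and $\mathrm{Ext}^1_{\mathcal{P}}(V,W)=0$ for all objects $W\in\mathrm{Rep}^\infty_k(G)$ of finite $I$-projective dimension.
   Context: Let $k$ be a field of characteristic $p>0$ and $G$ a topological group (possibly discrete) admitting an open pro-$p$ subgroup $I$. $\mathrm{Rep}_k^\infty(G)$ is the category of smooth $k$-linear $G$-representations (stabilizers of vectors are open). $\mathbb{X}=\mathrm{ind}_I^G(k)$ is the space of compactly supported $f:G\to k$ with $f(gi)=f(g)$ for $i\in I$, with action $(gf)(g')=f(g^{-1}g')$; $H=\mathrm{End}_G(\mathbb{X})^{\mathrm{op}}$; $\mathrm{Mod}(H)$ is the category of left $H$-modules; $F=\mathbb{X}\otimes_H(\cdot)$ is left adjoint to $U=(\cdot)^I$. $V$ is generated by its $I$-invariants if $V=k[G]\cdot V^I$. A ring is Gorenstein if it is left and right noetherian with finite injective dimension as a left and right module over itself. An $H$-module $M$ is Gorenstein projective if $M=\ker(d_0)=\mathrm{im}(d_1)$ for an acyclic complex $(Y_\bullet,d_\bullet)$ of projectives which stays exact under $\mathrm{Hom}_H(\cdot,P)$ for all projective $P$. The Gorenstein projective model structure on $\mathrm{Mod}(H)$ has as cofibrations the monomorphisms with Gorenstein projective cokernel, as fibrations the epimorphisms, and as trivial objects the modules of finite projective dimension (its trivial fibrations are the epimorphisms with kernel of finite projective dimension;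 its weak equivalences are the composites of a monomorphism with projective cokernel followed by a trivial fibration). The $I$-Gorenstein projective model structure on $\mathrm{Rep}^\infty_k(G)$ is its right transfer: $f$ is a fibration (resp. weak equivalence) iff $Uf$ is one in $\mathrm{Mod}(H)$; cofibrations are the maps with the left lifting property with respect to all trivial fibrations. A $G$-representation is $I$-projective if it is a direct summand of $FP$ for a projective $H$-module $P$. A sequence is $I$-exact if it is a complex and becomes exact after applying $U$. $W$ has finite $I$-projective dimension if there is an $I$-exact sequence $0\to X_n\to\cdots\to X_0\to W\to0$ with all $X_i$ $I$-projective. $\mathcal{P}$ is the class of sequences $0\to V'\to V\to V''\to0$ in $\mathrm{Rep}^\infty_k(G)$ which are both exact and $I$-exact; it is a proper class of short exact sequences in the sense of Mac Lane, and $\mathrm{Ext}^1_{\mathcal{P}}(V,W)$ is the group of Yoneda equivalence classes of extensions $0\to W\to E\to V\to0$ belonging to $\mathcal{P}$. *)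

(* Defs.v *)
From HB Require Import structures.
From mathcomp Require Import all_boot all_order all_algebra.
From mathcomp Require Import finmap.
From mathcomp Require Import all_classical topology.

Set Implicit Arguments.
Unset Strict Implicit.
Unset Printing Implicit Defensive.

Import GRing.Theory.
Local Open Scope classical_set_scope.
Local Open Scope card_scope.
Local Open Scope ring_scope.

HB.mixin Record isTopologicalGroup (G : Type) of Topological G & Group G := {
  mulg_continuous : continuous (fun x : G * G => (x.1 * x.2)%g) ;
  invg_continuous : continuous (fun x : G => x^-1%g)
}.

#[short(type="topologicalGroupType")]
HB.structure Definition TopologicalGroup :=
  {G of Topological G & Group G & isTopologicalGroup G}.

Section ProP.
Variable G : topologicalGroupType.
Implicit Types J N : set G.

Definition is_subgroup J :=
  [/\ J 1%g, forall x y, J x -> J y -> J (x * y)%g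
    & forall x, J x -> J x^-1%g].

(* [J] used as a type carries the subspace topology. *)
Definition open_in J N := open (set_val @^-1` N : set J).

(* A profinite group is a compact Hausdorff group whose open subgroups form a
   base of neighbourhoods of the identity. *)
Definition profinite J :=
  [/\ is_subgroup J, compact J, hausdorff_space J
    & forall U : set G, nbhs 1%g U ->
        exists N, [/\ is_subgroup N, N `<=` J, open_in J N & N `<=` U]].

Definition cosets_in J N : set (set G) :=
  [set [set (g * n)%g | n in N] | g in J].

(* A pro-p group is a profinite group all of whose open normal subgroups have
   index a power of p. *)
Definition pro_p (p : nat) J :=
  profinite J /\
  forall N, is_subgroup N -> N `<=` J -> open_in J N ->
    (forall g n, J g -> N n -> N (g^-1 * n * g)%g) ->
    exists m, cosets_in J N #= `I_(p ^ m).

Record open_pro_p_subgroup (p : nat) := OpenProPSubgroup {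
  opp_set : set G ;
  opp_pro_p : pro_p p opp_set ;
  opp_open : open opp_set
}.

End ProP.

Section TopologicalGroupTheory.
Variable G : topologicalGroupType.
Implicit Types (J : set G) (g : G).

Lemma mulgl_continuous g : continuous (fun x : G => (g * x)%g).
Proof.
move=> x; apply: (@continuous_comp _ _ _ (fun x => (g, x))
  (fun x : G * G => (x.1 * x.2)%g)); last exact: mulg_continuous.
by apply: cvg_pair => /=; [exact: cvg_cst|exact: cvg_id].
Qed.

Lemma mulgr_continuous g : continuous (fun x : G => (x * g)%g).
Proof.
move=> x; apply: (@continuous_comp _ _ _ (fun x => (x, g))
  (fun x : G * G => (x.1 * x.2)%g)); last exact: mulg_continuous.
by apply: cvg_pair => /=; [exact: cvg_id|exact: cvg_cst].
Qed.

Lemma nbhs1_subgroup_open J :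
  (forall x y, J x -> J y -> J (x * y)%g) -> nbhs 1%g J -> open J.
Proof.
move=> JM J1; rewrite openE => x Jx; rewrite /interior.
have := @mulgl_continuous x^-1%g x; rewrite /continuous_at mulVg.
move=> /(_ J J1) Jx1.
have {}Jx1 : nbhs x ((fun y => x^-1 * y)%g @^-1` J) by [].
suff: (fun y => x^-1 * y)%g @^-1` J `<=` J by move/filterS; exact.
move=> y /= Jy; by rewrite -(mulVKg x y); exact: JM.
Qed.

Lemma nbhs_subset (x : G) (A B : set G) : A `<=` B -> nbhs x A -> nbhs x B.
Proof. by move=> /filterS; exact. Qed.

End TopologicalGroupTheory.

Section SmoothRep.
Variables (k : fieldType) (G : topologicalGroupType).

Record smoothRep := SmoothRep {
  rep_sort :> lmodType k ;
  act : G -> rep_sort -> rep_sort ;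
  act_linear : forall g, linear (act g) ;
  act1 : forall v, act 1%g v = v ;
  actM : forall g h v, act (g * h)%g v = act g (act h v) ;
  act_smooth : forall v, open [set g | act g v = v]
}.

HB.instance Definition _ (V : smoothRep) (g : G) :=
  GRing.isLinear.Build k V V *:%R (act (s := V) g) (@act_linear V g).

Lemma actKV (V : smoothRep) g (v : V) : act g^-1%g (act g v) = v.
Proof. by rewrite -actM mulVg act1. Qed.

Record repHom (V W : smoothRep) := RepHom {
  hom_fun :> V -> W ;
  hom_linear : linear hom_fun ;
  hom_act : forall g v, hom_fun (act g v) = act g (hom_fun v)
}.

HB.instance Definition _ (V W : smoothRep) (f : repHom V W) :=
  GRing.isLinear.Build k V W *:%R f (hom_linear f).

Lemma repHomP (V W : smoothRep) (f g : repHom V W) : f =1 g -> f = g.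
Proof.
case: f g => [f lf af] [g lg ag] /= /funext fg; move: lf af lg ag.
by rewrite fg => *; congr RepHom; exact: Prop_irrelevance.
Qed.

HB.instance Definition _ (V W : smoothRep) := gen_eqMixin (repHom V W).
HB.instance Definition _ (V W : smoothRep) := gen_choiceMixin (repHom V W).

Lemma hom_comp_linear (U V W : smoothRep) (f : repHom V W) (g : repHom U V) :
  linear (fun v => f (g v)).
Proof. by move=> a u v; rewrite !linearP. Qed.
Lemma hom_comp_act (U V W : smoothRep) (f : repHom V W) (g : repHom U V) x v :
  f (g (act x v)) = act x (f (g v)).
Proof. by rewrite !hom_act. Qed.
Definition hom_comp (U V W : smoothRep) (f : repHom V W) (g : repHom U V) :=
  RepHom (hom_comp_linear f g) (hom_comp_act f g).

Definition hom_id_subproof (V : smoothRep) : linear (fun v : V => v) :=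
  fun _ _ _ => erefl.
Definition hom_id (V : smoothRep) : repHom V V :=
  RepHom (@hom_id_subproof V) (fun _ _ => erefl).

Lemma hom_zero_subproof (V W : smoothRep) : linear (fun _ : V => 0 : W).
Proof. by move=> a u v; rewrite scaler0 addr0. Qed.
Definition hom_zero (V W : smoothRep) : repHom V W :=
  RepHom (@hom_zero_subproof V W) (fun g v => esym (raddf0 (act g))).

End SmoothRep.

Section EndRing.
Variables (k : fieldType) (G : topologicalGroupType) (V : smoothRep k G).

Definition endRing := repHom V V.
HB.instance Definition _ := Choice.on endRing.

Implicit Types f g h : endRing.

Let end0 : endRing := hom_zero V V.
Let end1 : endRing := hom_id V.
Let endM f g : endRing := hom_comp f g.

Lemma endD_linear f g : linear (fun v : V => f v + g v : V).
Proof. by move=> a u v; rewrite !linearP scalerDr addrACA. Qed.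
Lemma endD_act f g x v : f (act x v) + g (act x v) = act x (f v + g v).
Proof. by rewrite !hom_act raddfD. Qed.
Definition endD f g : endRing := RepHom (endD_linear f g) (endD_act f g).

Lemma endN_linear f : linear (fun v : V => - f v : V).
Proof. by move=> a u v; rewrite linearP opprD scalerN. Qed.
Lemma endN_act f x v : - f (act x v) = act x (- f v).
Proof. by rewrite hom_act raddfN. Qed.
Definition endN f : endRing := RepHom (endN_linear f) (endN_act f).

Lemma endDA : associative endD.
Proof. by move=> f g h; apply: repHomP => v /=; rewrite addrA. Qed.
Lemma endDC : commutative endD.
Proof. by move=> f g; apply: repHomP => v /=; rewrite addrC. Qed.
Lemma endD0 : left_id end0 endD.
Proof. by move=> f; apply: repHomP => v /=; rewrite add0r. Qed.
Lemma endDN : left_inverse end0 endN endD.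
Proof. by move=> f; apply: repHomP => v /=; rewrite addNr. Qed.
Lemma endMA : associative endM.
Proof. by move=> f g h; apply: repHomP. Qed.
Lemma end1M : left_id end1 endM. Proof. by move=> f; apply: repHomP. Qed.
Lemma endM1 : right_id end1 endM. Proof. by move=> f; apply: repHomP. Qed.
Lemma endMDl : left_distributive endM endD.
Proof. by move=> f g h; apply: repHomP. Qed.
Lemma endMDr : right_distributive endM endD.
Proof. by move=> f g h; apply: repHomP => v /=; rewrite raddfD. Qed.

HB.instance Definition _ :=
  GRing.isZmodule.Build endRing endDA endDC endD0 endDN.
HB.instance Definition _ :=
  GRing.Zmodule_isPzRing.Build endRing endMA end1M endM1 endMDl endMDr.

End EndRing.

Section Induced.
Variables (k : fieldType) (p : nat) (G : topologicalGroupType).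
Variable I : open_pro_p_subgroup G p.

Local Notation J := (opp_set I).

Lemma opp_subgroup : is_subgroup J.
Proof. by case: (opp_pro_p I) => -[]. Qed.

Lemma opp_compact : compact J.
Proof. by case: (opp_pro_p I) => -[]. Qed.

Lemma opp1 : J 1%g. Proof. by case: opp_subgroup. Qed.
Lemma oppM x y : J x -> J y -> J (x * y)%g.
Proof. by case: opp_subgroup => _ + _; exact. Qed.
Lemma oppV x : J x -> J x^-1%g. Proof. by case: opp_subgroup => _ _; exact. Qed.

Lemma opp_lcoset_open g : open [set x | J (g^-1 * x)%g].
Proof.
by apply: (open_comp _ (opp_open I)) => x _; exact: mulgl_continuous.
Qed.

(* An element of the coset gI that depends only on this coset. *)
Definition coset_repr g : G := xget 1%g [set h | J (g^-1 * h)%g].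

Lemma coset_reprP g : J (g^-1 * coset_repr g)%g.
Proof.
rewrite /coset_repr; apply: (@xgetPex G 1%g [set h | J (g^-1 * h)%g]).
by exists g; rewrite /= mulVg; exact: opp1.
Qed.

Lemma coset_repr_eq g h : J (g^-1 * h)%g -> coset_repr g = coset_repr h.
Proof.
move=> Jgh; rewrite /coset_repr; congr xget; apply/seteqP; split=> x /= Jx.
  rewrite -(mulVKg g x) mulgA; apply: oppM => //.
  by rewrite -[X in J X]invgK invgM invgK; exact: oppV.
by rewrite -(mulVKg h x) mulgA; exact: oppM.
Qed.

Lemma coset_repr_id g : coset_repr (coset_repr g) = coset_repr g.
Proof. by apply/esym/coset_repr_eq/coset_reprP. Qed.

Lemma coset_reprM g i : J i -> coset_repr (g * i)%g = coset_repr g.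
Proof. by move=> Ji; apply/esym/coset_repr_eq; rewrite mulKg. Qed.

(* A set of representatives of G / I. *)
Definition transversal : set G := [set g | coset_repr g = g].

Definition ind_pred : {pred G -> k^o} := fun f =>
  `[< compact (closure [set g | f g <> 0]) /\
      forall g i, J i -> f (g * i)%g = f g >].

Lemma ind_submod : GRing.submod_closed ind_pred.
Proof.
split=> [|a f1 f2 /asboolP[c1 i1] /asboolP[c2 i2]]; apply/asboolP; split=> //.
- rewrite (_ : [set _ | _] = set0) ?closure0; first exact: compact0.
  by apply/seteqP; split=> g //=; exact.
- apply: (@subclosed_compact _ _
      (closure [set g | f1 g <> 0] `|` closure [set g | f2 g <> 0])).
  + exact: closed_closure.
  + exact: compactU.
  + rewrite -closureU; apply: closure_subset => g /= fg.
    apply: contrapT => /not_orP[/contrapT f1g /contrapT f2g]; apply: fg.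
    by rewrite !fctE f1g f2g scaler0 addr0.
- by move=> g i Ji; rewrite !fctE i1 ?i2.
Qed.

HB.instance Definition _ :=
  GRing.isSubmodClosed.Build k (G -> k^o) ind_pred ind_submod.

(* The space underlying ind_I^G(k). *)
Record ind_space := IndSpace {
  ind_fun :> G -> k^o ;
  ind_funP : ind_fun \in ind_pred
}.
HB.instance Definition _ := [isSub for ind_fun].
HB.instance Definition _ := [Choice of ind_space by <:].
HB.instance Definition _ := [SubChoice_isSubLmodule of ind_space by <:].

Lemma indE (f1 f2 : ind_space) : (forall g, f1 g = f2 g) -> f1 = f2.
Proof. by move/funext => f12; apply: val_inj. Qed.

Lemma ind_compact (f : ind_space) : compact (closure [set g | f g <> 0]).
Proof. by have /asboolP[] := ind_funP f. Qed.

Lemma ind_inv (f : ind_space) g i : J i -> f (g * i)%g = f g.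
Proof. by have /asboolP[_] := ind_funP f; exact. Qed.

Lemma ind_repr (f : ind_space) g : f (coset_repr g) = f g.
Proof.
by rewrite -(mulVKg g (coset_repr g)) ind_inv //; exact: coset_reprP.
Qed.

Lemma ind_act_subproof g (f : ind_space) :
  (fun x => f (g^-1 * x)%g : k^o) \in ind_pred.
Proof.
apply/asboolP; split=> [|x i Ji]; last by rewrite mulgA ind_inv.
set K := closure [set x | f x <> 0].
have cK : compact [set (g * x)%g | x in K].
  apply: continuous_compact; last exact: ind_compact.
  by apply: continuous_subspaceT; exact: mulgl_continuous.
apply: subclosed_compact cK _; first exact: closed_closure.
have -> : [set (g * x)%g | x in K] = (fun x => g^-1 * x)%g @^-1` K.
  apply/seteqP; split=> [_ [x Kx <-]|x /= Kx]; first by rewrite /= mulKg.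
  by exists (g^-1 * x)%g => //; rewrite mulVKg.
set L := _ @^-1` K; have /closure_id -> : closed L.
  apply: closed_comp; last exact: closed_closure.
  by move=> x _; exact: mulgl_continuous.
apply: closure_subset => x /= fx.
by rewrite /L /K /=; apply: subset_closure.
Qed.

Definition ind_act g f : ind_space := IndSpace (ind_act_subproof g f).

Lemma ind_act_linear g : linear (ind_act g).
Proof. by move=> a u v; apply: indE. Qed.
Lemma ind_act1 f : ind_act 1%g f = f.
Proof. by apply: indE => x /=; rewrite invg1 mul1g. Qed.
Lemma ind_actM g h f : ind_act (g * h)%g f = ind_act g (ind_act h f).
Proof. by apply: indE => x /=; rewrite invgM mulgA. Qed.

Lemma ind_char_subproof :
  (fun g => if `[< J g >] then 1 else 0 : k^o) \in ind_pred.
Proof.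
apply/asboolP; split=> [|g i Ji]; last first.
  case: asboolP => [Jgi|nJgi]; case: asboolP => //; first move=> nJg.
    by case: nJg; rewrite -(mulgK i g); apply: oppM => //; exact: oppV.
  by move=> Jg; case: nJgi; exact: oppM.
rewrite (_ : [set _ | _] = J); last first.
  apply/seteqP; split=> g /=; case: asboolP => // Jg _.
  by apply/eqP; rewrite oner_eq0.
suff -> : closure J = J by exact: opp_compact.
apply/esym/closure_id => x Jx.
have [|y [Jy Jxy]] := Jx [set y | J (x^-1 * y)%g].
  by apply: open_nbhs_nbhs; split; [exact: opp_lcoset_open|
    rewrite /= mulVg; exact: opp1].
have -> : x = (y * (x^-1 * y)^-1)%g by rewrite invgM invgK mulVKg.
by apply: oppM => //; exact: oppV.
Qed.

(* The characteristic function of I *)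
Definition ind_char : ind_space := IndSpace ind_char_subproof.

Lemma ind_charE g h :
  ind_act h ind_char g = if `[< J (h^-1 * g)%g >] then 1 else 0.
Proof. by []. Qed.

Lemma ind_cosets_finite (f : ind_space) :
  finite_set (transversal `&` [set g | f g <> 0]).
Proof.
pose T : ptopologicalType :=
  HB.pack_for ptopologicalType (TopologicalGroup.sort G)
    (TopologicalGroup.class G) (isPointed.Build (TopologicalGroup.sort G) 1%g).
have : cover_compact (closure [set g | f g <> 0] : set T).
  by rewrite -compact_cover; exact: ind_compact.
move=> /(_ G transversal (fun t => [set x | J (t^-1 * x)%g]))[|x _|D DT Dcov].
- by move=> t _; exact: opp_lcoset_open.
- exists (coset_repr x); first exact: coset_repr_id.
  have := oppV (coset_reprP x); rewrite invgM invgK; exact.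
apply: sub_finite_set (finite_fset D) => g -[/= Tg fg].
have [t tD Jtg] := Dcov g (@subset_closure T _ _ fg).
have /set_mem Tt := DT t tD.
by rewrite -Tg -(coset_repr_eq Jtg) [coset_repr t]Tt.
Qed.

Lemma ind_decomp (f : ind_space) :
  f = \sum_(t <- fset_set (transversal `&` [set g | f g <> 0]))
        f t *: ind_act t ind_char.
Proof.
apply: indE => g; set A := fset_set _.
rewrite -[RHS]/(\val (\sum_(t <- A) f t *: ind_act t ind_char) g).
rewrite raddf_sum fct_sumE.
have E t : t \in A -> \val (f t *: ind_act t ind_char) g =
    if t == coset_repr g then f g else 0.
  rewrite in_fset_set; last exact: ind_cosets_finite.
  rewrite inE => -[/= Tt _]; rewrite -[LHS]/(f t *: ind_act t ind_char g).
  rewrite ind_charE; case: asboolP => Jtg; case: eqP => tg.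
  - by rewrite tg ind_repr [_ *: _]mulr1.
  - by case: tg; rewrite -(coset_repr_eq Jtg).
  - by case: Jtg; rewrite tg -[X in J X]invgK invgM invgK;
      apply/oppV/coset_reprP.
  - by rewrite scaler0.
rewrite (eq_big_seq _ E) /=.
have [gA|gA] := boolP (coset_repr g \in A).
  rewrite (bigD1_seq (coset_repr g)) ?fset_uniq //= eqxx big1 ?addr0 //.
  by move=> t /negPf ->.
rewrite big1_seq => [|t /andP[_ tA]]; last first.
  by case: eqP => // tg; rewrite -tg tA in gA.
apply/eqP/negPn/negP => /eqP fg; case/negP: gA.
rewrite in_fset_set; last exact: ind_cosets_finite.
by rewrite inE; split; [exact: coset_repr_id|rewrite /= ind_repr].
Qed.

Lemma stab_nbhs1_lin (V : lmodType k) (a : G -> V -> V) c v w :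
  (forall g, linear (a g)) ->
  nbhs 1%g [set g | a g v = v] -> nbhs 1%g [set g | a g w = w] ->
  nbhs 1%g [set g | a g (c *: v + w) = c *: v + w].
Proof.
move=> la nv nw; apply: nbhs_subset (filterI nv nw) => g -[/= gv gw].
by rewrite la gv gw.
Qed.

Lemma ind_char_smooth t :
  nbhs 1%g [set g | ind_act g (ind_act t ind_char) = ind_act t ind_char].
Proof.
have : nbhs 1%g [set g | J (t^-1 * g * t)%g].
  apply: open_nbhs_nbhs; split; last by rewrite /= mulg1 mulVg; exact: opp1.
  apply: (@open_comp _ _ (fun g => t^-1 * g * t)%g _ _ (opp_open I)) => g _.
  apply: (@continuous_comp _ _ _ (fun g => t^-1 * g)%g (fun g => g * t)%g).
    exact: mulgl_continuous.
  exact: mulgr_continuous.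
apply: nbhs_subset => g /= Jg; apply: indE => x; rewrite -ind_actM !ind_charE.
rewrite invgM (_ : (t^-1 * g^-1 * x = (t^-1 * g * t)^-1 * (t^-1 * x)))%g.
  congr (if _ then _ else _); apply: asbool_equiv_eq; split=> Jx.
    by rewrite -(mulVKg (t^-1 * g * t)%g (t^-1 * x)%g); exact: oppM.
  by apply: oppM => //; exact: oppV.
by rewrite !invgM invgK -!mulgA mulVKg.
Qed.

Lemma ind_smooth (f : ind_space) : open [set g | ind_act g f = f].
Proof.
apply: nbhs1_subgroup_open => [g h /= gf hf|]; first by rewrite ind_actM hf.
rewrite {1 2}(ind_decomp f).
elim/big_ind : _ => [|u v nu nv|t _].
- rewrite (_ : [set _ | _] = setT); first exact: filterT.
  by apply/seteqP; split=> // g _; apply: indE.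
- by rewrite -[u]scale1r; apply: stab_nbhs1_lin => //; exact: ind_act_linear.
- rewrite -[_ *: _]addr0; apply: stab_nbhs1_lin; first exact: ind_act_linear.
    exact: ind_char_smooth.
  rewrite (_ : [set _ | _] = setT); first exact: filterT.
  by apply/seteqP; split=> // g _; apply: indE.
Qed.

Definition indRep : smoothRep k G :=
  SmoothRep ind_act_linear ind_act1 ind_actM ind_smooth.

(* H = End_G(X)^op, where X = ind_I^G(k) *)
Definition hecke : pzRingType := (endRing indRep)^c.

Section Frobenius.
Variable V : smoothRep k G.

Definition inv_pred : {pred V} := fun v => `[< forall i, J i -> act i v = v >].

Lemma inv_zmod : zmod_closed inv_pred.
Proof.
split=> [|u v /asboolP iu /asboolP iv]; apply/asboolP => i Ji.
  by rewrite raddf0.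
by rewrite raddfB /= iu // iv.
Qed.
HB.instance Definition _ := GRing.isZmodClosed.Build V inv_pred inv_zmod.

(* V^I *)
Record invariants := Invariants {
  inv_val :> V ;
  inv_valP : inv_val \in inv_pred
}.
HB.instance Definition _ := [isSub for inv_val].
HB.instance Definition _ := [Choice of invariants by <:].
HB.instance Definition _ := [SubChoice_isSubZmodule of invariants by <:].

Lemma inv_act (v : invariants) i : J i -> act i (v : V) = v.
Proof. by have /asboolP := inv_valP v; exact. Qed.

(* The G-map X -> V sending the characteristic function of I to v;
   it is unique by [ind_hom_eq]. *)
Definition frob_fun (v : V) (f : indRep) : V :=
  \sum_(t \in transversal) f t *: act t v.

Lemma frob_sum (A : set G) (v : V) (f : indRep) : finite_set A ->
  A `<=` transversal -> transversal `&` [set g | f g <> 0] `<=` A ->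
  frob_fun v f = \sum_(t <- fset_set A) f t *: act t v.
Proof.
move=> finA AT fA; rewrite -fsbig_finite // /frob_fun.
apply/esym/fsbig_widen => // t [Tt nAt] /=.
rewrite [f t](_ : _ = 0) ?scale0r //.
by apply: contrapT => ft; apply: nAt; apply: fA.
Qed.

Lemma frob_linear v : linear (frob_fun v).
Proof.
move=> a f1 f2.
pose A (f : indRep) := transversal `&` [set g | f g <> 0].
have fA f : finite_set (A f) by exact: ind_cosets_finite.
have finA : finite_set (A f1 `|` A f2) by rewrite finite_setU.
have AT : A f1 `|` A f2 `<=` transversal by move=> t [|] [].
rewrite (frob_sum _ finA AT) => [|t [Tt ft]]; last first.
  apply: contrapT => /not_orP[n1 n2]; apply: ft.
  have f1t : f1 t = 0 by apply: contrapT => ?; apply: n1.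
  have f2t : f2 t = 0 by apply: contrapT => ?; apply: n2.
  by rewrite -[LHS]/(a *: f1 t + f2 t) f1t f2t scaler0 addr0.
rewrite !(frob_sum _ finA AT) => [|t At|t At]; [|by right|by left].
rewrite scaler_sumr -big_split /=; apply: eq_bigr => t _.
by rewrite scalerA -scalerDl.
Qed.

Lemma frob_act (v : invariants) g (f : indRep) :
  frob_fun v (act g f) = act g (frob_fun v f).
Proof.
pose F x : V := f x *: act x (v : V).
have Frepr x : F (coset_repr x) = F x.
  rewrite /F (ind_repr f) -(mulVKg x (coset_repr x)) actM inv_act //.
  exact: coset_reprP.
have bij : set_bij transversal transversal (fun t => coset_repr (g^-1 * t)%g).
  split=> [t _|s t /set_mem Ts /set_mem Tt st|t Tt]; first exact: coset_repr_id.
    rewrite -[s]Ts -[t]Tt; apply: coset_repr_eq.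
    have := coset_reprP (g^-1 * s)%g; rewrite {}st => Js.
    have := oppV (coset_reprP (g^-1 * t)%g) => /(oppM Js).
    by rewrite !invgM !invgK -!mulgA mulVKg mulVKg.
  exists (coset_repr (g * t)%g); first exact: coset_repr_id.
  rewrite -[RHS]Tt; apply/esym/coset_repr_eq; rewrite mulgA.
  by have := coset_reprP (g * t)%g; rewrite invgM.
pose A := transversal `&` [set t | f t <> 0].
have finA : finite_set A by exact: ind_cosets_finite.
transitivity (\sum_(t \in transversal) act g (F t)).
  rewrite (reindex_fsbig _ _ _ _ bij); apply: eq_fsbigr => t _.
  by rewrite Frepr /F linearZ /= -actM mulVKg.
rewrite (frob_sum _ finA) // => [|t []//]; rewrite raddf_sum.
rewrite -fsbig_finite //; apply/esym/fsbig_widen => [t []//|t [Tt nAt] /=].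
rewrite /F [f t](_ : _ = 0) ?scale0r ?raddf0 //.
by apply: contrapT => ft; apply: nAt.
Qed.

Definition frob (v : invariants) : repHom indRep V :=
  RepHom (frob_linear v) (@frob_act v).

Lemma frob_char (v : invariants) : frob v ind_char = v.
Proof.
rewrite /= (@frob_sum [set coset_repr 1%g]) //; last first.
- move=> t [/= Tt]; case: asboolP => // Jt _.
  by rewrite -[LHS]Tt; apply/esym/coset_repr_eq; rewrite invg1 mul1g.
- by move=> _ ->; exact: coset_repr_id.
have Jr : J (coset_repr 1%g).
  by have := coset_reprP 1%g; rewrite invg1 mul1g.
by rewrite fset_set1 big_seq_fset1 /= asboolT // scale1r inv_act.
Qed.

Lemma ind_hom_eq (f1 f2 : repHom indRep V) :
  f1 ind_char = f2 ind_char -> f1 = f2.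
Proof.
move=> f12; apply: repHomP => x; rewrite (ind_decomp x) !linear_sum /=.
apply: eq_bigr => t _; rewrite !linearZ /=; congr (_ *: _).
by rewrite -[ind_act t _]/(act (s := indRep) t ind_char) !hom_act f12.
Qed.

Lemma ind_char_inv i : J i -> act (s := indRep) i ind_char = ind_char.
Proof.
move=> Ji; apply: indE => x; rewrite ind_charE /=.
congr (if _ then _ else _); apply: asbool_equiv_eq; split=> Jx.
  by rewrite -(mulVKg i x); exact: oppM.
by apply: oppM => //; exact: oppV.
Qed.

Lemma hom_char_inv (f : repHom indRep V) : f ind_char \in inv_pred.
Proof. by apply/asboolP => i Ji; rewrite -hom_act ind_char_inv. Qed.

(* The left H-module structure of V^I, transported along the bijection
   Hom_G(X, V) = V^I sending phi to its value at the characteristic function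
   of I; H acts on Hom_G(X, V) by precomposition. *)
Definition hecke_act (h : hecke) (v : invariants) : invariants :=
  Invariants (hom_char_inv (hom_comp (frob v) (h : endRing indRep))).

Lemma frob_hecke (h : hecke) (v : invariants) :
  frob (hecke_act h v) = hom_comp (frob v) (h : endRing indRep).
Proof. by apply: ind_hom_eq; rewrite frob_char. Qed.

Lemma frobD (u v : invariants) x : frob (u + v) x = frob u x + frob v x.
Proof.
pose A := transversal `&` [set t | x t <> 0].
have finA : finite_set A by exact: ind_cosets_finite.
have AT : A `<=` transversal by move=> t [].
have AA : A `<=` A by [].
rewrite /= !(frob_sum _ finA AT AA).
rewrite -big_split /=; apply: eq_bigr => t _.
by rewrite -scalerDr -raddfD.
Qed.

Lemma hecke_actA (a b : hecke) v :
  hecke_act a (hecke_act b v) = hecke_act (a * b) v.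
Proof.
apply: val_inj; have := frob_hecke b v.
by move/(congr1 (fun g : repHom _ _ => g ((a : endRing indRep) ind_char))).
Qed.

Lemma hecke_act1 : left_id 1 hecke_act.
Proof. by move=> v; apply: val_inj; exact: frob_char. Qed.

Lemma hecke_actDr : right_distributive hecke_act +%R.
Proof. by move=> h u v; apply: val_inj; exact: frobD. Qed.

Lemma hecke_actDl v : {morph hecke_act^~ v : a b / a + b}.
Proof. by move=> a b; apply: val_inj; exact: (raddfD (frob v)). Qed.

HB.instance Definition _ := GRing.Zmodule_isLmodule.Build hecke invariants
  hecke_actA hecke_act1 hecke_actDr hecke_actDl.

End Frobenius.

Section InvariantsFunctor.
Variables (V W : smoothRep k G) (f : repHom V W).

Lemma inv_map_subproof (v : invariants V) : f v \in inv_pred (V := W).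
Proof. by apply/asboolP => i Ji; rewrite -hom_act inv_act. Qed.

Definition inv_map v : invariants W := Invariants (inv_map_subproof v).

Lemma inv_map_linear : linear inv_map.
Proof.
move=> h u v; apply: val_inj; rewrite /= linearD /=; congr (_ + _).
have : hom_comp f (frob u) = frob (inv_map u).
  apply: ind_hom_eq.
  by rewrite frob_char -[LHS]/(f (frob u ind_char)) frob_char.
by move/(congr1 (fun g : repHom _ _ => g ((h : endRing indRep) ind_char))).
Qed.
HB.instance Definition _ := GRing.isLinear.Build hecke (invariants V)
  (invariants W) *:%R inv_map inv_map_linear.

End InvariantsFunctor.

End Induced.

Section Tensor.
Variables (k : fieldType) (G : topologicalGroupType) (Y : smoothRep k G).
Variable M : lmodType (endRing Y)^c.

Local Notation formal_sum := (seq (Y * M)).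

(* The congruence on formal sums of pure tensors presenting Y (x)_H M, where
   H = End_G(Y)^op acts on Y from the right by y.h = h y. *)
Inductive tens_eq : formal_sum -> formal_sum -> Prop :=
| tens_refl s : tens_eq s s
| tens_sym s t : tens_eq s t -> tens_eq t s
| tens_trans s t u : tens_eq s t -> tens_eq t u -> tens_eq s u
| tens_cat s s' t t' : tens_eq s s' -> tens_eq t t' ->
    tens_eq (s ++ t) (s' ++ t')
| tens_comm s t : tens_eq (s ++ t) (t ++ s)
| tens_0l m : tens_eq [:: (0, m)] [::]
| tens_Dl y y' m : tens_eq [:: (y + y', m)] [:: (y, m); (y', m)]
| tens_Dr y m m' : tens_eq [:: (y, m + m')] [:: (y, m); (y, m')]
| tens_bal y (h : endRing Y) m :
    tens_eq [:: (h y, m)] [:: (y, (h : (endRing Y)^c) *: m)].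

Definition tens_rel : rel formal_sum := fun s t => `[< tens_eq s t >].

Lemma tens_rel_refl : reflexive tens_rel.
Proof. by move=> s; apply/asboolP; exact: tens_refl. Qed.
Lemma tens_rel_sym : symmetric tens_rel.
Proof. by move=> s t; apply: asbool_equiv_eq; split; exact: tens_sym. Qed.
Lemma tens_rel_trans : transitive tens_rel.
Proof.
move=> t s u /asboolP st /asboolP tu; apply/asboolP; exact: tens_trans tu.
Qed.
Canonical tens_equiv := EquivRel tens_rel tens_rel_refl tens_rel_sym
  tens_rel_trans.

Definition tensor := {eq_quot tens_equiv}%qT.
HB.instance Definition _ := Choice.on tensor.

Definition tens_sum (s : formal_sum) : tensor := (\pi_(tensor) s)%qT.
Definition tens (y : Y) (m : M) : tensor := tens_sum [:: (y, m)].

Lemma tens_sumP s t : tens_sum s = tens_sum t <-> tens_eq s t.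
Proof. by split=> [/eqmodP/asboolP|st]; last by apply/eqmodP/asboolP. Qed.

Lemma tens_sumK (x : tensor) : tens_sum (repr x) = x.
Proof. exact: reprK. Qed.

Lemma tens_repr s : tens_eq (repr (tens_sum s)) s.
Proof. by apply/tens_sumP; rewrite tens_sumK. Qed.

Let tens_add (x y : tensor) : tensor := tens_sum (repr x ++ repr y).

Let tens_addE s t : tens_add (tens_sum s) (tens_sum t) = tens_sum (s ++ t).
Proof. by apply/tens_sumP; apply: tens_cat; exact: tens_repr. Qed.

Let tens_addA : associative tens_add.
Proof.
move=> x y z; rewrite -(tens_sumK x) -(tens_sumK y) -(tens_sumK z).
by rewrite !tens_addE catA.
Qed.
Let tens_addC : commutative tens_add.
Proof. by move=> x y; apply/tens_sumP; exact: tens_comm. Qed.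
Let tens_add0 : left_id (tens_sum [::]) tens_add.
Proof. by move=> x; rewrite -(tens_sumK x) tens_addE. Qed.

HB.instance Definition _ :=
  GRing.isNmodule.Build tensor tens_addA tens_addC tens_add0.

Lemma tens_sumD s t : tens_sum s + tens_sum t = tens_sum (s ++ t).
Proof. exact: tens_addE. Qed.

Lemma tens_sumE s : tens_sum s = \sum_(u <- s) tens u.1 u.2.
Proof.
elim: s => [|[y m] s IHs]; first by rewrite big_nil.
by rewrite big_cons -IHs tens_sumD.
Qed.

Lemma tensE (x : tensor) : x = \sum_(u <- repr x) tens u.1 u.2.
Proof. by rewrite -tens_sumE tens_sumK. Qed.

Lemma tens0l m : tens 0 m = 0.
Proof. by apply/tens_sumP; exact: tens_0l. Qed.
Lemma tensDl y y' m : tens (y + y') m = tens y m + tens y' m.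
Proof. by rewrite tens_sumD; apply/tens_sumP; exact: tens_Dl. Qed.
Lemma tensDr y m m' : tens y (m + m') = tens y m + tens y m'.
Proof. by rewrite tens_sumD; apply/tens_sumP; exact: tens_Dr. Qed.
Lemma tens_balanced y (h : endRing Y) m :
  tens (h y) m = tens y ((h : (endRing Y)^c) *: m).
Proof. by apply/tens_sumP; exact: tens_bal. Qed.

(* The endomorphism a (x) id of the tensor product. *)
Section TensMap.
Variable a : {additive Y -> Y}.
Hypothesis aH : forall (h : endRing Y) y, a (h y) = h (a y).

Lemma tens_map_subproof s t : tens_eq s t ->
  \sum_(u <- s) tens (a u.1) u.2 = \sum_(u <- t) tens (a u.1) u.2.
Proof.
elim=> {s t} [//|//|s t u _ -> _ -> //|s s' t t' _ IHs _ IHt|s t|m|y y' m|y m m'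
  |y h m]; rewrite ?big_cat ?big_cons ?big_nil /= ?addr0.
- by rewrite IHs IHt.
- by rewrite addrC.
- by rewrite raddf0 tens0l.
- by rewrite raddfD tensDl.
- by rewrite tensDr.
- by rewrite aH tens_balanced.
Qed.

Definition tens_map (x : tensor) : tensor :=
  \sum_(u <- repr x) tens (a u.1) u.2.

Lemma tens_map_sum s : tens_map (tens_sum s) = \sum_(u <- s) tens (a u.1) u.2.
Proof. by apply: tens_map_subproof; exact: tens_repr. Qed.

Lemma tens_mapT y m : tens_map (tens y m) = tens (a y) m.
Proof. by rewrite tens_map_sum big_cons big_nil addr0. Qed.

Lemma tens_mapD : {morph tens_map : x y / x + y}.
Proof.
move=> x y; rewrite -(tens_sumK x) -(tens_sumK y) tens_sumD.
by rewrite !tens_map_sum big_cat.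
Qed.

Lemma tens_map0 : tens_map 0 = 0.
Proof. by rewrite -[0]/(tens_sum [::]) tens_map_sum big_nil. Qed.

Lemma tens_map_bigE s :
  tens_map (\sum_(u <- s) tens u.1 u.2) = \sum_(u <- s) tens (a u.1) u.2.
Proof. by rewrite -tens_sumE tens_map_sum. Qed.

Lemma tens_map_comp (b : {additive Y -> Y}) (x : tensor) :
  tens_map (\sum_(u <- repr x) tens (b u.1) u.2) =
  \sum_(u <- repr x) tens (a (b u.1)) u.2.
Proof.
rewrite (big_morph tens_map tens_mapD tens_map0).
by apply: eq_bigr => u _; exact: tens_mapT.
Qed.

End TensMap.

Let oppH (h : endRing Y) y : - h y = h (- y).
Proof. by rewrite raddfN. Qed.

Let tens_opp := tens_map -%R.

Let tens_addN : left_inverse 0 tens_opp +%R.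
Proof.
move=> x; rewrite {2}(tensE x) -big_split big1 //= => u _.
by rewrite -tensDl addNr tens0l.
Qed.

HB.instance Definition _ := GRing.Nmodule_isZmodule.Build tensor tens_addN.

Let scaleH c (h : endRing Y) y : c *: h y = h (c *: y).
Proof. by rewrite linearZ. Qed.

Let tens_scale c := tens_map ( *:%R c).

Let tens_scaleA c d x : tens_scale c (tens_scale d x) = tens_scale (c * d) x.
Proof.
rewrite /tens_scale {2}/tens_map tens_map_comp; last exact: scaleH.
by apply: eq_bigr => u _; rewrite /= scalerA.
Qed.
Let tens_scale1 : left_id 1 tens_scale.
Proof.
move=> x; by rewrite [RHS]tensE; apply: eq_bigr => u _; rewrite /= scale1r.
Qed.
Let tens_scaleDr : right_distributive tens_scale +%R.
Proof. by move=> c x y; rewrite /tens_scale tens_mapD //; exact: scaleH. Qed.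
Let tens_scaleDl x : {morph tens_scale^~ x : c d / c + d}.
Proof.
move=> c d; rewrite -big_split; apply: eq_bigr => u _ /=.
by rewrite scalerDl tensDl.
Qed.

HB.instance Definition _ := GRing.Zmodule_isLmodule.Build k tensor
  tens_scaleA tens_scale1 tens_scaleDr tens_scaleDl.

Lemma scale_tens c y m : c *: tens y m = tens (c *: y) m.
Proof. by apply: tens_mapT; exact: scaleH. Qed.

Let actH g (h : endRing Y) y : act g (h y) = h (act g y).
Proof. by rewrite hom_act. Qed.

Definition tens_act g : tensor -> tensor := tens_map (act g).

Lemma tens_actE g y m : tens_act g (tens y m) = tens (act g y) m.
Proof. by apply: tens_mapT; exact: actH. Qed.

Lemma tens_act_linear g : linear (tens_act g).
Proof.
move=> c x y; rewrite /tens_act tens_mapD; last exact: actH.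
congr (_ + _); rewrite [in LHS](tensE x) scaler_sumr.
rewrite (big_morph _ (tens_mapD (actH g)) (tens_map0 (actH g))).
rewrite {2}/tens_map scaler_sumr; apply: eq_bigr => u _.
by rewrite !scale_tens (tens_mapT (actH g)) /= linearZ.
Qed.

Lemma tens_act1 x : tens_act 1%g x = x.
Proof. by rewrite [RHS]tensE; apply: eq_bigr => u _; rewrite /= act1. Qed.

Lemma tens_actM g h x : tens_act (g * h)%g x = tens_act g (tens_act h x).
Proof.
rewrite /tens_act {3}/tens_map tens_map_comp; last exact: actH.
by apply: eq_bigr => u _; rewrite /= actM.
Qed.

Lemma tens_act_smooth x : open [set g | tens_act g x = x].
Proof.
apply: nbhs1_subgroup_open => [g h /= gx hx|]; first by rewrite tens_actM hx.
have st0 : nbhs 1%g [set g | tens_act g 0 = 0].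
  rewrite (_ : [set _ | _] = setT); first exact: filterT.
  by apply/seteqP; split=> // g _; apply: tens_map0; exact: actH.
rewrite {1 2}(tensE x); elim/big_ind : _ => // [u v nu nv|u _].
  by rewrite -[u]scale1r; apply: stab_nbhs1_lin => //; exact: tens_act_linear.
apply: (@nbhs_subset _ _ [set g | act g u.1 = u.1]) => [g /= gu|].
  by rewrite tens_actE gu.
apply: open_nbhs_nbhs; split; first exact: act_smooth.
by rewrite /= act1.
Qed.

Definition tensRep : smoothRep k G :=
  SmoothRep tens_act_linear tens_act1 tens_actM tens_act_smooth.

End Tensor.

Definition surjective (A B : Type) (f : A -> B) := forall y, exists x, f x = y.

Definition exact_at (A B C : zmodType) (f : A -> B) (g : B -> C) :=
  forall y, g y = 0 <-> exists x, f x = y.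

Definition short_exact (A B C : zmodType) (f : A -> B) (g : B -> C) :=
  [/\ injective f, exact_at f g & surjective g].

Definition is_zero (A : zmodType) := forall x : A, x = 0.

Section Modules.
Variable R : pzRingType.

Definition projective (M : lmodType R) :=
  forall (A B : lmodType R) (q : {linear A -> B}) (f : {linear M -> B}),
    surjective q -> exists g : {linear M -> A}, forall x, q (g x) = f x.

Definition injective_module (M : lmodType R) :=
  forall (A B : lmodType R) (j : {linear A -> B}) (f : {linear A -> M}),
    injective j -> exists g : {linear B -> M}, forall x, g (j x) = f x.

(* A resolution of length n is indexed by nat, with zero terms beyond n. *)
Definition fin_proj_dim (M : lmodType R) :=
  exists (n : nat) (P : nat -> lmodType R)
         (d : forall i, {linear P i.+1 -> P i}) (e : {linear P 0%N -> M}),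
    [/\ forall i, (i <= n)%N -> projective (P i),
        forall i, (n < i)%N -> is_zero (P i),
        surjective e,
        exact_at (d 0%N) e
      & forall i, exact_at (d i.+1) (d i)].

Definition fin_inj_dim (M : lmodType R) :=
  exists (n : nat) (E : nat -> lmodType R)
         (d : forall i, {linear E i -> E i.+1}) (e : {linear M -> E 0%N}),
    [/\ forall i, (i <= n)%N -> injective_module (E i),
        forall i, (n < i)%N -> is_zero (E i),
        injective e,
        exact_at e (d 0%N)
      & forall i, exact_at (d i) (d i.+1)].

Definition noetherian (M : lmodType R) :=
  forall N : {pred M}, GRing.submod_closed N ->
    exists s : seq M, forall x, x \in N <->
      exists c : nat -> R, x = \sum_(i < size s) c i *: s`_i.

(* The fibrations and weak equivalences of the Gorenstein projective model
   structure on left R-modules. *)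
Definition mod_fibration (M N : lmodType R) (f : {linear M -> N}) :=
  surjective f.

Definition mod_trivial_fibration (M N : lmodType R) (f : {linear M -> N}) :=
  exists (K : lmodType R) (j : {linear K -> M}),
    short_exact j f /\ fin_proj_dim K.

Definition mod_mono_proj_coker (M N : lmodType R) (f : {linear M -> N}) :=
  exists (C : lmodType R) (c : {linear N -> C}),
    short_exact f c /\ projective C.

Definition mod_weak_equiv (M N : lmodType R) (f : {linear M -> N}) :=
  exists (L : lmodType R) (i : {linear M -> L}) (q : {linear L -> N}),
    [/\ mod_mono_proj_coker i, mod_trivial_fibration q
      & forall x, f x = q (i x)].

End Modules.

(* Right modules over R are the left modules over R^c. *)
Definition gorenstein (R : pzRingType) :=
  [/\ @noetherian R R^o, @noetherian R^c (R^c)^o,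
      @fin_inj_dim R R^o & @fin_inj_dim R^c (R^c)^o].

Section Constructions.
Variables (k : fieldType) (G : topologicalGroupType).

Definition zero_act (g : G) (v : 'rV[k]_0) := v.
Lemma zero_act_linear g : linear (zero_act g). Proof. by []. Qed.
Lemma zero_act_smooth v : open [set g | zero_act g v = v].
Proof. by rewrite (_ : [set _ | _] = setT); [exact: openT|exact/seteqP]. Qed.
Definition zeroRep : smoothRep k G :=
  SmoothRep zero_act_linear (fun=> erefl) (fun _ _ _ => erefl) zero_act_smooth.

Variables V W : smoothRep k G.

Definition sum_act g (x : V * W) : V * W := (act g x.1, act g x.2).
Lemma sum_act_linear g : linear (sum_act g).
Proof. by move=> a x y; rewrite /sum_act /= !linearP. Qed.
Lemma sum_act1 x : sum_act 1%g x = x.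
Proof. by case: x => v w; rewrite /sum_act !act1. Qed.
Lemma sum_actM g h x : sum_act (g * h)%g x = sum_act g (sum_act h x).
Proof. by rewrite /sum_act !actM. Qed.
Lemma sum_act_smooth x : open [set g | sum_act g x = x].
Proof.
rewrite (_ : [set _ | _] =
  [set g | act g x.1 = x.1] `&` [set g | act g x.2 = x.2]).
  by apply: openI; exact: act_smooth.
case: x => v w; apply/seteqP; split=> g; first by case.
by rewrite /sum_act => -[/= -> ->].
Qed.
Definition sumRep : smoothRep k G :=
  SmoothRep sum_act_linear sum_act1 sum_actM sum_act_smooth.

Lemma sum_inl_linear : linear (fun v : V => (v, 0) : sumRep).
Proof. by move=> a u v; congr pair; rewrite /= scaler0 addr0. Qed.
Lemma sum_inl_act g v : (act g v, 0) = act (s := sumRep) g (v, 0).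
Proof. by rewrite /= /sum_act raddf0. Qed.
Definition sum_inl : repHom V sumRep := RepHom sum_inl_linear sum_inl_act.

Lemma sum_snd_linear : linear (fun x : sumRep => x.2 : W). Proof. by []. Qed.
Definition sum_snd : repHom sumRep W :=
  RepHom sum_snd_linear (fun _ _ => erefl).

End Constructions.

Section GorensteinProjectiveStructure.
Variables (k : fieldType) (p : nat) (G : topologicalGroupType).
Variable I : open_pro_p_subgroup G p.
Implicit Types V W X Y : smoothRep k G.

Local Notation H := (hecke k I).

(* The functor U on morphisms *)
Definition Umap V W (f : repHom V W) :
    {linear invariants I V -> invariants I W} :=
  inv_map (I := I) f.

(* The functor F on objects *)
Definition Fobj (M : lmodType H) : smoothRep k G := tensRep (Y := indRep k I) M.

Definition I_fibration V W (f : repHom V W) := mod_fibration (Umap f).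

Definition I_weak_equiv V W (f : repHom V W) := mod_weak_equiv (Umap f).

Definition left_lifting A B V W (i : repHom A B) (q : repHom V W) :=
  forall (u : repHom A V) (v : repHom B W), (forall x, q (u x) = v (i x)) ->
    exists h : repHom B V,
      (forall x, h (i x) = u x) /\ (forall y, q (h y) = v y).

Definition I_cofibration A B (i : repHom A B) :=
  forall V W (q : repHom V W),
    I_fibration q -> I_weak_equiv q -> left_lifting i q.

Definition I_cofibrant V := I_cofibration (hom_zero (zeroRep k G) V).

Definition generated_by_invariants V :=
  forall v : V, exists s : seq (k * G * invariants I V),
    v = \sum_(t <- s) t.1.1 *: act t.1.2 (t.2 : V).

Definition I_projective X :=
  exists (P : lmodType H) (Y : smoothRep k G)
         (f : repHom (sumRep X Y) (Fobj P)),
    projective P /\ bijective f.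

Definition I_exact_at X V W (f : repHom X V) (g : repHom V W) :=
  (forall x, g (f x) = 0) /\ exact_at (Umap f) (Umap g).

Definition fin_I_proj_dim W :=
  exists (n : nat) (X : nat -> smoothRep k G)
         (d : forall i, repHom (X i.+1) (X i)) (e : repHom (X 0%N) W),
    [/\ forall i, (i <= n)%N -> I_projective (X i),
        forall i, (n < i)%N -> is_zero (X i),
        surjective (Umap e),
        I_exact_at (d 0%N) e
      & forall i, I_exact_at (d i.+1) (d i)].

(* The class P of sequences that are both exact and I-exact; the complex
   condition in I-exactness is part of exactness. *)
Definition P_exact W E V (i : repHom W E) (q : repHom E V) :=
  short_exact i q /\ short_exact (Umap i) (Umap q).

Record P_extension V W := PExtension {
  ext_mid : smoothRep k G ;
  ext_inj : repHom W ext_mid ;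
  ext_proj : repHom ext_mid V ;
  ext_exact : P_exact ext_inj ext_proj
}.

Definition yoneda_equiv V W (E E' : P_extension V W) :=
  exists f : repHom (ext_mid E) (ext_mid E'),
    [/\ bijective f, forall w, f (ext_inj E w) = ext_inj E' w
      & forall x, ext_proj E' (f x) = ext_proj E x].

Lemma split_P_exact V W : P_exact (sum_inl W V) (sum_snd W V).
Proof.
split; split.
- by move=> w w' [].
- move=> [w v]; split=> /= [-> |[x [_ <-]] //]; by exists w.
- by move=> v; exists (0, v).
- by move=> w w' /(congr1 \val) [/val_inj].
- move=> x; split=> [/(congr1 \val) /= x0|[w <-]]; last exact: val_inj.
  have wI : (x : sumRep W V).1 \in inv_pred I (V := W).
    by apply/asboolP => i Ji; by have /(congr1 fst) := inv_act x Ji.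
  exists (Invariants wI); apply: val_inj.
  by rewrite [RHS]surjective_pairing x0.
- move=> v.
  have vI : ((0, v : V) : sumRep W V) \in inv_pred I (V := sumRep W V).
    apply/asboolP => i Ji; congr pair; first exact: raddf0.
    exact: inv_act.
  by exists (Invariants vI); exact: val_inj.
Qed.

Definition split_extension V W : P_extension V W :=
  PExtension (split_P_exact V W).

(* The zero element of Ext^1_P(V, W) is the class of the split extension. *)
Definition Ext1_P_zero V W :=
  forall E : P_extension V W, yoneda_equiv E (split_extension V W).

End GorensteinProjectiveStructure.

(* Main.v *)
Require Import Defs.
From HB Require Import structures.
From mathcomp Require Import all_boot all_order all_algebra.
From mathcomp Require Import finmap.
From mathcomp Require Import all_classical topology.

Set Implicit Arguments.
Unset Strict Implicit.
Unset Printing Implicit Defensive.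

Import GRing.Theory.
Local Open Scope ring_scope.

(** Since the zero representation is the source of the map whose lifting
property defines cofibrancy, V is cofibrant iff every map V -> B lifts along
every q : A -> B for which U q is a surjective weak equivalence of H-modules
([I_cofibrantP]).

Two facts translate this condition into homological algebra.  A surjective
weak equivalence of modules has a kernel of finite projective dimension, because
this kernel is a direct summand, with projective complement, of the kernel of
the trivial fibration occurring in the weak equivalence
([weak_equiv_kernel]).  Furthermore W has finite I-projective dimension iff
U W has finite projective dimension ([fin_I_proj_dim_U]): the unit P -> U F P
is bijective for projective P ([unit_bijective]), so that U and F carry
resolutions to resolutions.

If V is cofibrant, lift the identity of V along the inclusion of k[G].V^I:
this inclusion becomes an isomorphism under U, and the lift makes it surjective,
so V is generated by its invariants.  In an extension of V by W in the class P,
with W of finite I-projective dimension, U of the projection is surjective with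
kernel U W, hence a trivial fibration; lifting the identity of V splits the
extension.

Conversely, let q : A -> B be as above and v : V -> B.  As V is generated by its
invariants and U q is surjective, v takes its values in the image of q, so the
pullback of q along v is an extension of V by the kernel of q, and it belongs
to P.  This kernel has finite I-projective dimension by the two facts above.
The extension therefore splits, and a splitting, projected to A, is a lift of
v. *)

(** * Submodules and injections *)

Section Submodules.
Variable R : pzRingType.

Record submodule (M : lmodType R) (S : submodClosed M) := Submodule {
  sub_val :> M ;
  sub_valP : sub_val \in (S : {pred M})
}.

HB.instance Definition _ (M : lmodType R) (S : submodClosed M) :=
  [isSub for @sub_val M S].
HB.instance Definition _ (M : lmodType R) (S : submodClosed M) :=
  [Choice of submodule S by <:].
HB.instance Definition _ (M : lmodType R) (S : submodClosed M) :=
  [SubChoice_isSubLmodule of submodule S by <:].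

Definition ker_pred (M N : lmodType R) (f : {linear M -> N}) : {pred M} :=
  fun x => f x == 0.

Lemma ker_pred_closed (M N : lmodType R) (f : {linear M -> N}) :
  GRing.submod_closed (ker_pred f).
Proof.
split=> [|a x y /eqP fx /eqP fy]; apply/eqP; first exact: raddf0.
by rewrite linearP fx fy scaler0 addr0.
Qed.

HB.instance Definition _ (M N : lmodType R) (f : {linear M -> N}) :=
  GRing.isSubmodClosed.Build R M (ker_pred f) (ker_pred_closed f).

Definition sub_incl (M : lmodType R) (S : submodClosed M) :
  {linear submodule S -> M} := \val.

End Submodules.

Lemma surjective_injective_inverse (A B : Type) (f : A -> B) :
  injective f -> surjective f -> exists g, cancel f g /\ cancel g f.
Proof.
move=> fI fS; pose g y := projT1 (cid (fS y)).
have gK : cancel g f by move=> y; exact: (projT2 (cid (fS y))).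
by exists g; split=> // x; apply: fI; rewrite gK.
Qed.

(** * Projective modules and projective dimension *)

Section Projectives.
Variable R : pzRingType.
Implicit Types M N L P C K : lmodType R.

Lemma projective_retract M N (s : {linear M -> N}) (r : {linear N -> M}) :
  cancel s r -> projective N -> projective M.
Proof.
move=> sK projN A B q f qS.
have [g gq] := projN A B q (f \o r) qS.
by exists (g \o s) => x /=; rewrite gq /= sK.
Qed.

Lemma projective_iso M N (f : {linear M -> N}) :
  injective f -> surjective f -> projective M -> projective N.
Proof.
move=> fI fS; have [g [fK gK]] := surjective_injective_inverse fI fS.
pose gl : {linear N -> M} := HB.pack g
  (GRing.isLinear.Build R N M *:%R g (can2_linear fK gK)).
exact: (@projective_retract N M gl f).
Qed.

Lemma zero_projective M : is_zero M -> projective M.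
Proof.
move=> M0 A B q f _; exists \0 => x.
by rewrite (M0 x) !raddf0.
Qed.

Lemma zero_fin_proj_dim M : is_zero M -> fin_proj_dim M.
Proof.
move=> M0; exists 0%N, (fun=> M), (fun=> \0), \0.
split=> //; first by move=> i _; exact: zero_projective.
- by move=> x; exists 0; rewrite (M0 x).
- by move=> x; split=> // _; exists 0; rewrite (M0 x).
- by move=> i x; split=> // _; exists 0; rewrite (M0 x).
Qed.

(** The identity is a monomorphism with zero, hence projective, cokernel. *)
Lemma trivial_fibration_weak_equiv M N (f : {linear M -> N}) :
  mod_trivial_fibration f -> mod_weak_equiv f.
Proof.
move=> fT; exists M, idfun, f; split=> //.
have Z0 : is_zero ('rV[R]_0 : lmodType R) by move=> x; rewrite [x]thinmx0.
exists 'rV[R]_0, \0; split; last exact: zero_projective.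
split=> // [y|y]; last by exists 0; rewrite [y]thinmx0.
by split=> // _; exists y.
Qed.

Section FreeModule.
Variable M : lmodType R.

Definition finite_support_pred : {pred M -> R^o} := fun f =>
  `[< exists A : {fset M}, forall x, x \notin A -> f x = 0 >].

Lemma finite_support_closed : GRing.submod_closed finite_support_pred.
Proof.
split=> [|a f g /asboolP[A fA] /asboolP[B gB]]; apply/asboolP.
  by exists fset0.
exists (A `|` B)%fset => x; rewrite in_fsetU negb_or => /andP[xA xB].
by rewrite !fctE fA // gB // scaler0 addr0.
Qed.

HB.instance Definition _ := GRing.isSubmodClosed.Build R (M -> R^o)
  finite_support_pred finite_support_closed.

Definition free_on := submodule finite_support_pred.
HB.instance Definition _ := GRing.Lmodule.on free_on.

Definition coef (f : free_on) : M -> R := sub_val f.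

Lemma free_finite_support (f : free_on) :
  exists A : {fset M}, forall x, x \notin A -> coef f x = 0.
Proof. by have /asboolP := sub_valP f. Qed.

Definition free_eval (f : free_on) : M :=
  \sum_(x \in [set: M]) coef f x *: x.

Lemma free_evalE (A : {fset M}) (f : free_on) :
  (forall x, x \notin A -> coef f x = 0) ->
  free_eval f = \sum_(x <- A) coef f x *: x.
Proof. by move=> fA; apply: fsbigTE => x /fA ->; rewrite scale0r. Qed.

Lemma free_eval_linear : linear free_eval.
Proof.
move=> a f g.
have [A fA] := free_finite_support f; have [B gB] := free_finite_support g.
rewrite !(@free_evalE (A `|` B)%fset) => [|x|x|x]; last first.
- rewrite in_fsetU negb_or => /andP[xA xB].
  by rewrite -[LHS]/(a * coef f x + coef g x) fA ?gB ?mulr0 ?addr0.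
- by rewrite in_fsetU negb_or => /andP[/fA].
- by rewrite in_fsetU negb_or => /andP[_ /gB].
rewrite scaler_sumr -big_split; apply: eq_bigr => x _ /=.
by rewrite scalerA -scalerDl.
Qed.

HB.instance Definition _ :=
  GRing.isLinear.Build R free_on M *:%R free_eval free_eval_linear.

Lemma free_eval_surjective : surjective free_eval.
Proof.
move=> m; pose d (x : M) : R^o := if x == m then 1 else 0.
have dP : d \in (finite_support_pred : {pred _}).
  apply/asboolP; exists [fset m]%fset => x; rewrite inE /d.
  by case: eqP.
exists (Submodule dP : free_on).
rewrite (@free_evalE [fset m]%fset) => [|x /=]; last first.
  by rewrite inE /d; case: eqP.
by rewrite big_seq_fset1 /= /d eqxx scale1r.
Qed.

End FreeModule.

(** Any section of the canonical surjection onto P of the free module on the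
elements of P has coordinates that form a dual basis.  Only finitely many
coordinates of a vector are nonzero, so finitely many vectors can be expanded
over a common list; this is the form used for a sum of pure tensors. *)
Lemma projective_dual_basis P : projective P ->
  exists f : P -> {linear P -> R^o}, forall ms : seq P, exists xs : seq P,
    forall m, m \in ms -> m = \sum_(x <- xs) (f x m : R) *: x.
Proof.
move=> projP.
have [s sK] := projP _ _ (@free_eval P : {linear free_on P -> P})
  (idfun : {linear P -> P}) (@free_eval_surjective P).
have coordL x : linear (fun m => coef (s m) x : R^o).
  by move=> a u v; rewrite linearP.
pose f x : {linear P -> R^o} := HB.pack (fun m => coef (s m) x : R^o)
  (GRing.isLinear.Build R P R^o *:%R _ (coordL x)).
exists f => ms.
have [A sA] : exists A : {fset P}, forall m, m \in ms ->
    forall x, x \notin A -> coef (s m) x = 0.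
  elim: ms => [|m ms [A sA]]; first by exists fset0.
  have [B sB] := free_finite_support (s m).
  exists (A `|` B)%fset => n; rewrite inE => /predU1P[->|nms] x;
    rewrite in_fsetU negb_or => /andP[xA xB]; [exact: sB|exact: sA].
exists A => m mms; rewrite -[LHS]sK; apply: free_evalE.
exact: sA.
Qed.

(** As C is projective, c splits, and P is the direct sum of its kernel
and C. *)
Lemma ker_projective P C (c : {linear P -> C}) :
  surjective c -> projective C -> projective P ->
  projective (submodule (ker_pred c)).
Proof.
move=> cS projC projP.
have [s sK] := projC _ _ c idfun cS.
have rP x : x - s (c x) \in ker_pred c by apply/eqP; rewrite raddfB /= sK subrr.
pose r x : submodule (ker_pred c) := Submodule (rP x).
have rL : linear r.
  by move=> a x y; apply: val_inj; rewrite /= !linearP /= scalerDr addrACA.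
pose rl : {linear P -> submodule (ker_pred c)} := HB.pack r
  (GRing.isLinear.Build R P _ *:%R r rL).
apply: (@projective_retract _ P (sub_incl (ker_pred c)) rl) => // x.
by apply: val_inj; rewrite /= (eqP (sub_valP x)) raddf0 subr0.
Qed.

Lemma factor_through_injection M N K (j : {linear K -> M})
    (f : {linear N -> M}) :
  injective j -> (forall y, exists x, j x = f y) ->
  exists g : {linear N -> K}, forall y, j (g y) = f y.
Proof.
move=> jI jf; pose g y := projT1 (cid (jf y)).
have jg y : j (g y) = f y by exact: (projT2 (cid (jf y))).
have gL : linear g by move=> a x y; apply: jI; rewrite linearP !jg linearP.
pose gl : {linear N -> K} := HB.pack g
  (GRing.isLinear.Build R N K *:%R g gL).
by exists gl.
Qed.

(** A resolution P of M becomes a resolution of the kernel K when P_0 is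
replaced by the kernel of the surjection P_0 -> M -> C.  This kernel is
projective because C is, and it contains the kernel of P_0 -> M, so that
exactness at the lower end is preserved. *)
Lemma kernel_fin_proj_dim K M C (j : {linear K -> M}) (c : {linear M -> C}) :
  short_exact j c -> projective C -> fin_proj_dim M -> fin_proj_dim K.
Proof.
move=> [jI jc cS] projC [n [P [d [e [projP P0 eS dE ddE]]]]].
pose ce : {linear P 0%N -> C} := c \o e.
have ceS : surjective ce.
  by move=> z; have [x <-] := cS z; have [y <-] := eS x; exists y.
pose Q := submodule (ker_pred ce); pose inc := sub_incl (ker_pred ce).
have [e' je'] : exists e' : {linear Q -> K}, forall x, j (e' x) = e (inc x).
  apply: (@factor_through_injection M Q K j (e \o inc)) => // x.
  by apply/jc; exact: (eqP (sub_valP x)).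
have [d' incd'] : exists d' : {linear P 1%N -> Q},
    forall x, inc (d' x) = d 0%N x.
  apply: factor_through_injection => [|y]; first exact: val_inj.
  have edy : e (d 0%N y) = 0 by apply/dE; exists y.
  have dyQ : d 0%N y \in ker_pred ce by apply/eqP; rewrite /= edy raddf0.
  by exists (Submodule dyQ).
pose P' i : lmodType R := if i is 0%N then Q else P i.
pose dd i : {linear P' i.+1 -> P' i} :=
  match i return {linear P' i.+1 -> P' i} with 0%N => d' | i'.+1 => d i'.+1 end.
exists n, P', dd, e'; split.
- case=> [_|i /projP //]; apply: ker_projective => //; exact: projP.
- by case=> // i /P0.
- move=> x; have [y ey] := eS (j x).
  have yQ : y \in ker_pred ce by apply/eqP; rewrite /= ey; apply/jc; exists x.
  by exists (Submodule yQ); apply: jI; rewrite je'.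
- move=> y; split=> [e'y|[x <-]].
    have [x dx] : exists x, d 0%N x = inc y.
      by apply/dE; rewrite -je' e'y raddf0.
    by exists x; apply: val_inj; rewrite -[LHS]/(inc (d' x)) incd'.
  by apply: jI; rewrite je' incd' raddf0; apply/dE; exists x.
- case=> [|i] y; last exact: ddE.
  rewrite -[dd 0%N]/d' -[dd 1%N]/(d 1%N); rewrite -(ddE 0%N y) -incd'.
  by split=> [->|/eqP]; [rewrite raddf0|move=> /eqP d'y; apply: val_inj].
Qed.

(** Factor f as a monomorphism i : M -> L with projective cokernel C followed by
a trivial fibration q with kernel K'.  Then K embeds into K' through i, and as
f is surjective, every element of L is congruent to an element of K' modulo
i(M).  So K' maps onto C, with kernel K. *)
Lemma weak_equiv_kernel M N K (f : {linear M -> N}) (j : {linear K -> M}) :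
  mod_weak_equiv f -> short_exact j f -> fin_proj_dim K.
Proof.
move=> [L [i [q [[C [c [[iI ic cS] projC]]]
  [K' [j' [[jI' jq qS] fpdK']]] fqi]]]].
move=> [jI jf fS].
have [h jh] : exists h : {linear K -> K'}, forall x, j' (h x) = i (j x).
  apply: (@factor_through_injection L K K' j' (i \o j)) => // x.
  by apply/jq; rewrite -fqi; apply/jf; exists x.
apply: (@kernel_fin_proj_dim K K' C h (c \o j')) => //; split.
- by move=> x y /(congr1 j'); rewrite !jh => /iI /jI.
- move=> y; split=> [/ic[m im]|[x <-]].
    have [x jx] : exists x, j x = m.
      by apply/jf; rewrite fqi im; apply/jq; exists y.
    by exists x; apply: jI'; rewrite jh jx.
  by rewrite /= jh; apply/ic; exists (j x).
- move=> z; have [l <-] := cS z; have [m fm] := fS (q l).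
  have [y jy] : exists y, j' y = l - i m.
    by apply/jq; rewrite raddfB /= -fqi fm subrr.
  exists y; rewrite /= jy raddfB /=.
  by have -> : c (i m) = 0 by [apply/ic; exists m]; rewrite subr0.
Qed.
End Projectives.

(** * Kernels and sums of smooth representations *)

Section SmoothRepresentations.
Variables (k : fieldType) (G : topologicalGroupType).
Implicit Types V W X A B : smoothRep k G.

Lemma repHom_inverse V W (f : repHom V W) :
  injective f -> surjective f ->
  exists g : repHom W V, cancel f g /\ cancel g f.
Proof.
move=> fI fS; have [g [fK gK]] := surjective_injective_inverse fI fS.
have gact x w : g (act x w) = act x (g w) by apply: fI; rewrite hom_act !gK.
by exists (RepHom (can2_linear fK gK) gact).
Qed.

Section Subrepresentation.
Variables (V : smoothRep k G) (S : submodClosed V).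
Hypothesis S_act : forall g v,
  v \in (S : {pred V}) -> act g v \in (S : {pred V}).

Definition subrep_act g (v : submodule S) : submodule S :=
  Submodule (S_act g (sub_valP v)).

Lemma subrep_act_linear g : linear (subrep_act g).
Proof. by move=> a u v; apply: val_inj; rewrite /= linearP. Qed.
Lemma subrep_act1 v : subrep_act 1%g v = v.
Proof. by apply: val_inj; rewrite /= act1. Qed.
Lemma subrep_actM g h v :
  subrep_act (g * h)%g v = subrep_act g (subrep_act h v).
Proof. by apply: val_inj; rewrite /= actM. Qed.
Lemma subrep_act_smooth v : open [set g | subrep_act g v = v]%classic.
Proof.
rewrite (_ : [set _ | _]%classic = [set g | act g (val v) = val v]%classic).
  exact: act_smooth.
by apply/seteqP; split=> g /= => [/(congr1 val)|gv] //; exact: val_inj.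
Qed.

Definition subrep : smoothRep k G :=
  SmoothRep subrep_act_linear subrep_act1 subrep_actM subrep_act_smooth.

Definition subrep_incl : repHom subrep V :=
  @RepHom k G subrep V (sub_incl S) (linearP (sub_incl S)) (fun _ _ => erefl).

End Subrepresentation.

Lemma ker_act V W (f : repHom V W) g v :
  v \in ker_pred f -> act g v \in ker_pred f.
Proof. by move=> /eqP fv; apply/eqP; rewrite [LHS]hom_act [f v]fv raddf0. Qed.

Definition ker_rep V W (f : repHom V W) : smoothRep k G :=
  subrep (@ker_act V W f).

Definition ker_incl V W (f : repHom V W) : repHom (ker_rep f) V :=
  subrep_incl (@ker_act V W f).

Definition sum_fst V W : repHom (sumRep V W) V :=
  @RepHom k G (sumRep V W) V fst (fun _ _ _ => erefl) (fun _ _ => erefl).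

Lemma sum_inr_linear V W : linear (fun w : W => (0, w) : sumRep V W).
Proof. by move=> a u v; congr pair; rewrite /= scaler0 addr0. Qed.
Lemma sum_inr_act V W g (w : W) : (0, act g w) = act (s := sumRep V W) g (0, w).
Proof. by rewrite /= /sum_act raddf0. Qed.
Definition sum_inr V W : repHom W (sumRep V W) :=
  RepHom (@sum_inr_linear V W) (@sum_inr_act V W).

Lemma sum_hom_linear V W X (f : repHom V X) (g : repHom W X) :
  linear (fun x : sumRep V W => f x.1 + g x.2).
Proof. by move=> a x y; rewrite !linearP scalerDr addrACA. Qed.
Lemma sum_hom_act V W X (f : repHom V X) (g : repHom W X) a (x : sumRep V W) :
  f (act a x).1 + g (act a x).2 = act a (f x.1 + g x.2).
Proof. by rewrite !hom_act raddfD. Qed.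
Definition sum_hom V W X (f : repHom V X) (g : repHom W X) :
    repHom (sumRep V W) X :=
  RepHom (sum_hom_linear f g) (sum_hom_act f g).

Section KernelFactorization.
Variables (A B X : smoothRep k G) (q : repHom A B) (f : repHom X A).
Hypothesis qf0 : forall x, q (f x) = 0.

Lemma ker_lift_subproof x : f x \in ker_pred q.
Proof. by apply/eqP; exact: qf0. Qed.
Lemma ker_lift_linear :
  linear (fun x => Submodule (ker_lift_subproof x) : ker_rep q).
Proof. by move=> a x y; apply: val_inj; rewrite /= linearP. Qed.
Lemma ker_lift_act g x : Submodule (ker_lift_subproof (act g x)) =
  act (s := ker_rep q) g (Submodule (ker_lift_subproof x)).
Proof. by apply: val_inj; rewrite /= hom_act. Qed.
Definition ker_lift : repHom X (ker_rep q) :=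
  RepHom ker_lift_linear ker_lift_act.

End KernelFactorization.

Lemma ker_short_exact A B (q : repHom A B) :
  injective (ker_incl q) /\ exact_at (ker_incl q) q.
Proof.
split=> [|y]; first exact: val_inj.
split=> [qy|[x <-]]; last exact: (eqP (sub_valP x)).
have yK : y \in ker_pred q by apply/eqP.
by exists (Submodule yK).
Qed.

End SmoothRepresentations.

(** * The adjunction between Hecke modules and representations *)

Section HeckeModules.
Variables (k : fieldType) (p : nat) (G : topologicalGroupType).
Variable I : open_pro_p_subgroup G p.
Implicit Types V W X : smoothRep k G.
Local Notation H := (hecke k I).
Local Notation indX := (indRep k I).
Local Notation chi := (ind_char k I).
Implicit Types M N P : lmodType H.

Lemma tens0r M (y : indX) : tens y (0 : M) = 0.
Proof. by apply: (addrI (tens y (0 : M))); rewrite -tensDr !addr0. Qed.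

Lemma Fobj_is_zero M : is_zero M -> is_zero (Fobj M).
Proof.
move=> M0 x; rewrite [x]tensE big1 // => u _.
by rewrite [u.2]M0 tens0r.
Qed.

Definition tens_left M (m : M) : repHom indX (Fobj M).
Proof.
refine (@RepHom k G indX (Fobj M) (fun y => tens y m) _ _).
- by move=> a y z; rewrite tensDl scale_tens.
- by move=> g y; rewrite /= tens_actE.
Defined.

(** The unit M -> U F M of the adjunction, m |-> chi (x) m. *)
Definition unit_fun M (m : M) : invariants I (Fobj M) :=
  Invariants (hom_char_inv (tens_left m)).

Lemma frob_unit M (m : M) : frob (unit_fun m) = tens_left m.
Proof. by apply: ind_hom_eq; rewrite frob_char. Qed.

Lemma unit_linear M : linear (@unit_fun M).
Proof.
move=> h m n; apply: val_inj; rewrite /= tensDr -tens_balanced.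
congr (_ + _).
by rewrite -[RHS]/(frob (unit_fun m) ((h : endRing indX) chi)) frob_unit.
Qed.
HB.instance Definition _ M :=
  GRing.isLinear.Build H M (invariants I (Fobj M)) *:%R
    (@unit_fun M) (@unit_linear M).

(** The translates of chi span the induced representation, so F M is generated
by the elements chi (x) m. *)
Lemma Fobj_hom_eq M V (f g : repHom (Fobj M) V) :
  (forall m, f (unit_fun m) = g (unit_fun m)) -> f =1 g.
Proof.
move=> fg x; rewrite [x]tensE !raddf_sum; apply: eq_bigr => u _.
rewrite -[tens _ _]/(tens_left u.2 u.1).
have /(congr1 (fun h : repHom _ _ => h u.1)) :
    hom_comp f (tens_left u.2) = hom_comp g (tens_left u.2).
  by apply: ind_hom_eq; exact: fg.
by [].
Qed.

(** The G-map F M -> V adjoint to f : M -> U V sends y (x) m to the image of y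
under the map from the induced representation to V determined by the invariant
vector f m. *)
Section Adjoint.
Variables (M : lmodType H) (V : smoothRep k G).
Variable f : {linear M -> invariants I V}.

Let adj_sum (s : seq (indX * M)) : V := \sum_(u <- s) frob (f u.2) u.1.

Lemma adj_sum_eq s t : tens_eq s t -> adj_sum s = adj_sum t.
Proof.
rewrite /adj_sum.
elim=> {s t} [//|//|s t u _ -> _ -> //|s s' t t' _ IHs _ IHt|s t|m|y y' m|y m m'
  |y h m]; rewrite ?big_cat ?big_cons ?big_nil /= ?addr0.
- by rewrite IHs IHt.
- by rewrite addrC.
- exact: (raddf0 (frob (f m))).
- exact: (raddfD (frob (f m))).
- by rewrite raddfD; exact: frobD.
- rewrite linearZ.
  by have /(congr1 (fun g : repHom indX V => g y)) := frob_hecke h (f m).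
Qed.

Definition adj_fun (x : Fobj M) : V := adj_sum (repr (x : tensor M)).

Lemma adj_fun_sum s : adj_fun (tens_sum s) = adj_sum s.
Proof. by apply: adj_sum_eq; exact: tens_repr. Qed.

Lemma adj_fun_tens y m : adj_fun (tens y m) = frob (f m) y.
Proof. by rewrite adj_fun_sum /adj_sum big_cons big_nil addr0. Qed.

Lemma adj_funD : {morph adj_fun : x y / x + y}.
Proof.
move=> x y; rewrite -[x]tens_sumK -[y]tens_sumK.
by rewrite tens_sumD !adj_fun_sum /adj_sum big_cat.
Qed.

Lemma adj_fun0 : adj_fun 0 = 0.
Proof. by rewrite -[0]/(tens_sum [::]) adj_fun_sum /adj_sum big_nil. Qed.

Lemma adj_fun_big s :
  adj_fun (\sum_(u <- s) tens u.1 u.2) = \sum_(u <- s) frob (f u.2) u.1.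
Proof. by rewrite -tens_sumE adj_fun_sum. Qed.

Lemma adj_linear : linear adj_fun.
Proof.
move=> a x y; rewrite adj_funD; congr (_ + _).
rewrite [x]tensE scaler_sumr (big_morph _ adj_funD adj_fun0) adj_fun_big.
rewrite scaler_sumr; apply: eq_bigr => u _.
by rewrite scale_tens adj_fun_tens linearZ.
Qed.

Lemma adj_act g x : adj_fun (act g x) = act g (adj_fun x).
Proof.
rewrite [x]tensE raddf_sum (big_morph _ adj_funD adj_fun0) adj_fun_big.
rewrite raddf_sum; apply: eq_bigr => u _.
rewrite -[X in adj_fun X]/(tens_act g (tens u.1 u.2)) tens_actE adj_fun_tens.
exact: (hom_act (frob (f u.2)) g u.1).
Qed.

Definition adj : repHom (Fobj M) V := RepHom adj_linear adj_act.

Lemma adj_tens y m : adj (tens y m) = frob (f m) y.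
Proof. exact: adj_fun_tens. Qed.

Lemma adj_unit m : Umap I adj (unit_fun m) = f m.
Proof. by apply: val_inj; rewrite /= adj_fun_tens frob_char. Qed.

End Adjoint.

(** Evaluation at chi identifies the regular module H with the invariants of the
induced representation. *)
Definition hecke_inv_fun (h : H^o) : invariants I indX :=
  Invariants (hom_char_inv (h : endRing indX)).

Lemma hecke_inv_linear : linear hecke_inv_fun.
Proof.
move=> a h h'; apply: val_inj => /=; congr (_ + _).
have : frob (hecke_inv_fun h) = (h : endRing indX).
  by apply: ind_hom_eq; rewrite frob_char.
by move/(congr1 (fun g : repHom indX indX => g ((a : endRing indX) chi))).
Qed.

Definition hecke_inv : {linear H^o -> invariants I indX} :=
  HB.pack hecke_inv_fun
  (GRing.isLinear.Build H H^o (invariants I indX) *:%R _ hecke_inv_linear).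

Lemma frob_hecke_inv (h : H) :
  frob (hecke_inv h) = (h : endRing indX) :> repHom indX indX.
Proof. by apply: ind_hom_eq; rewrite frob_char. Qed.

(** Let X be the induced representation.  Each coordinate function f_x : P -> H
of a dual basis extends to a G-map phi_x : F P -> X, which sends y (x) m to
f_x(m)(y), and every z in F P is a finite sum of terms phi_x(z) (x) x.  If
chi (x) m = 0, then f_x(m)(chi) = 0 and hence f_x(m) = 0 for all x, so m = 0.
If z is invariant, then so is phi_x(z), which is therefore h_x(chi) for some
h_x in H, and z is the image of the sum of the h_x x. *)
Lemma unit_bijective P : projective P ->
  injective (@unit_fun P) /\ surjective (@unit_fun P).
Proof.
move=> projP; have [f fP] := projective_dual_basis projP.
pose phi x : repHom (Fobj P) indX := adj (hecke_inv \o f x).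
have phiE x y m : phi x (tens y m) = (f x m : endRing indX) y.
  rewrite /phi adj_tens.
  by have /(congr1 (fun g : repHom indX indX => g y)) := frob_hecke_inv (f x m).
have expand (z : Fobj P) :
    exists xs : seq P, z = \sum_(x <- xs) tens (phi x z) x.
  have [xs xsP] := fP (map snd (repr (z : tensor P))).
  exists xs.
  transitivity (\sum_(u <- repr (z : tensor P))
      \sum_(x <- xs) tens (phi x (tens u.1 u.2)) x).
    rewrite {1}[z]tensE; apply: eq_big_seq => u uz.
    rewrite {1}(xsP u.2 (map_f _ uz)).
    rewrite (big_morph _ (@tensDr _ _ indX P u.1) (tens0r P u.1)).
    by apply: eq_bigr => x _; rewrite phiE tens_balanced.
  rewrite exchange_big; apply: eq_bigr => x _.
  have -> : phi x z = \sum_(u <- repr (z : tensor P)) phi x (tens u.1 u.2).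
    by rewrite {1}[z]tensE; exact: (raddf_sum (phi x)).
  by rewrite (big_morph (fun y => tens y x) (fun y y' => tensDl y y' x)
    (tens0l x)).
split=> [|z].
  apply: raddf_inj => m um0; have [xs xsP] := fP [:: m].
  rewrite (xsP m (mem_head _ _)) big1 // => x _.
  have -> : f x m = 0; last by rewrite scale0r.
  apply: ind_hom_eq; rewrite -phiE.
  by have /(congr1 val) /= -> := um0; exact: (raddf0 (phi x)).
have [xs zE] := expand (z : Fobj P).
exists (\sum_(x <- xs) (frob (Umap I (phi x) z) : H) *: x); rewrite raddf_sum.
apply: val_inj; rewrite [RHS]zE raddf_sum; apply: eq_bigr => x _.
rewrite [LHS](_ : _ =
  tens (chi : indX) ((frob (Umap I (phi x) z) : H) *: x)) //.
by rewrite -tens_balanced frob_char.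
Qed.

Lemma U_Fobj_projective P : projective P -> projective (invariants I (Fobj P)).
Proof.
move=> projP; have [uI uS] := unit_bijective projP.
exact: (projective_iso uI uS projP).
Qed.

End HeckeModules.

(** * I-projective dimension and cofibrant objects *)

Section CofibrantObjects.
Variables (k : fieldType) (p : nat) (G : topologicalGroupType).
Variable I : open_pro_p_subgroup G p.
Implicit Types V W X K A B : smoothRep k G.
Local Notation H := (hecke k I).

Lemma I_projective_U_projective X :
  I_projective I X -> projective (invariants I X).
Proof.
move=> [P [Y [f [projP [g fK gK]]]]].
have [||h [hf fh]] := @repHom_inverse k G _ _ f.
- exact: can_inj fK.
- by move=> y; exists (g y).
apply: (@projective_retract _ _ _ (Umap I (hom_comp f (sum_inl X Y)))
  (Umap I (hom_comp (sum_fst X Y) h)) _ (U_Fobj_projective projP)).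
by move=> x; apply: val_inj; rewrite /= hf.
Qed.

Lemma Fobj_I_projective (P : lmodType H) :
  projective P -> I_projective I (Fobj P).
Proof.
move=> projP; exists P, (zeroRep k G), (sum_fst _ _); split=> //.
exists (sum_inl _ _) => // -[x y]; congr pair.
by rewrite [LHS]thinmx0 [RHS]thinmx0.
Qed.

(** A preimage of an invariant vector under an injective G-map is invariant. *)
Lemma U_left_exact K A B (i : repHom K A) (q : repHom A B) :
  injective i -> exact_at i q ->
  injective (Umap I i) /\ exact_at (Umap I i) (Umap I q).
Proof.
move=> iI iq; split=> [x y /(congr1 val) /iI /val_inj //|y].
split=> [/(congr1 val) /iq[x xy]|[x <-]]; last first.
  by apply: val_inj; apply/iq; exists (x : K).
have xI : x \in inv_pred I (V := K).
  by apply/asboolP => g Jg; apply: iI; rewrite hom_act xy inv_act.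
by exists (Invariants xI); apply: val_inj.
Qed.

(** Apply U to an I-projective resolution of W, and F to a projective
resolution of U W, composing with the counit F U W -> W.  In the second case,
applying U gives back the given resolution, up to the unit isomorphisms of the
projective terms. *)
Lemma fin_I_proj_dim_U W : fin_I_proj_dim I W <-> fin_proj_dim (invariants I W).
Proof.
split=> [[n [X [d [e [projX X0 eS [_ dE] ddE]]]]]|
         [n [P [d [e [projP P0 eS dE ddE]]]]]].
  exists n, (fun i => invariants I (X i)), (fun i => Umap I (d i)), (Umap I e).
  split=> //; first by move=> i /projX /I_projective_U_projective.
    by move=> i /X0 Xi0 x; apply: val_inj; exact: Xi0.
  by move=> i; have [] := ddE i.
have projPi i : projective (P i).
  by have [/projP//|/P0 /zero_projective] := leqP i n.
have unitI i : injective (@unit_fun _ _ _ I (P i)).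
  by have [] := unit_bijective (projPi i).
have unitS i : surjective (@unit_fun _ _ _ I (P i)).
  by have [] := unit_bijective (projPi i).
pose Fd i : repHom (Fobj (P i.+1)) (Fobj (P i)) :=
  adj (@unit_fun _ _ _ I (P i) \o d i).
have FdE i m : Umap I (Fd i) (unit_fun m) = unit_fun (d i m).
  by rewrite adj_unit.
exists n, (fun i => Fobj (P i)), Fd, (adj e); split.
- by move=> i _; exact: Fobj_I_projective.
- by move=> i /P0; exact: Fobj_is_zero.
- by move=> w; have [x <-] := eS w; exists (unit_fun x); rewrite adj_unit.
- split.
    apply: (@Fobj_hom_eq _ _ _ _ _ _ (hom_comp (adj e) (Fd 0%N))
      (hom_zero _ _)) => m.
    have := congr1 (Umap I (adj e)) (FdE 0%N m); rewrite adj_unit.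
    have -> : e (d 0%N m) = 0 by apply/dE; exists m.
    by move/(congr1 val).
  move=> y; have [m <-] := unitS _ y; rewrite adj_unit; split.
    by move/dE => [x <-]; exists (unit_fun x); exact: FdE.
  move=> [x]; have [m' <-] := unitS _ x; rewrite FdE => /unitI <-.
  by apply/dE; exists m'.
- move=> i; split.
    apply: (@Fobj_hom_eq _ _ _ _ _ _ (hom_comp (Fd i) (Fd i.+1))
      (hom_zero _ _)) => m.
    have := congr1 (Umap I (Fd i)) (FdE i.+1 m); rewrite [RHS]FdE.
    have -> : d i (d i.+1 m) = 0 by apply/ddE; exists m.
    by rewrite raddf0 => /(congr1 val).
  move=> y; have [m <-] := unitS _ y; rewrite FdE; split.
    rewrite -(raddf0 (@unit_fun _ _ _ I (P i))) => /unitI /ddE [x <-].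
    by exists (unit_fun x); exact: FdE.
  move=> [x]; have [m' <-] := unitS _ x; rewrite FdE => /unitI <-.
  by have -> : d i (d i.+1 m') = 0; [apply/ddE; exists m'|rewrite raddf0].
Qed.

Lemma I_cofibrantP V : I_cofibrant I V <->
  forall A B (q : repHom A B) (v : repHom V B),
    I_fibration I q -> I_weak_equiv I q ->
    exists h : repHom V A, forall y, q (h y) = v y.
Proof.
split=> [cofV A B q v fq wq|lift A B q fq wq u v _].
  have [|h [_ qh]] := cofV A B q fq wq (hom_zero _ _) v; last by exists h.
  by move=> x; rewrite /= !raddf0.
have [h qh] := lift A B q v fq wq; exists h; split=> // x.
by rewrite /= raddf0 (_ : x = 0) ?raddf0 //; exact: thinmx0.
Qed.

(** The subrepresentation k[G].V^I of V has the same invariants as V. *)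
Section GeneratedSubrepresentation.
Variable V : smoothRep k G.

Definition generated_pred : {pred V} := fun v =>
  `[< exists s : seq (k * G * invariants I V),
        v = \sum_(t <- s) t.1.1 *: act t.1.2 (t.2 : V) >].

Lemma generated_closed : GRing.submod_closed generated_pred.
Proof.
split=> [|a u v /asboolP[s ->] /asboolP[t ->]]; apply/asboolP.
  by exists [::]; rewrite big_nil.
exists ([seq (a * x.1.1, x.1.2, x.2) | x <- s] ++ t).
rewrite big_cat big_map scaler_sumr; congr (_ + _); apply: eq_bigr => x _.
by rewrite scalerA.
Qed.
HB.instance Definition _ :=
  GRing.isSubmodClosed.Build k V generated_pred generated_closed.

Lemma generated_act g v : v \in generated_pred -> act g v \in generated_pred.
Proof.
move=> /asboolP[s ->]; apply/asboolP.
exists [seq (x.1.1, (g * x.1.2)%g, x.2) | x <- s].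
rewrite big_map raddf_sum; apply: eq_bigr => x _.
by rewrite /= actM linearZ_LR.
Qed.

Definition generated_incl := subrep_incl generated_act.

Lemma generated_incl_surjective_U : surjective (Umap I generated_incl).
Proof.
move=> v; have vG : (v : V) \in generated_pred.
  by apply/asboolP; exists [:: (1, 1%g, v)]; rewrite big_seq1 scale1r act1.
have vI : (Submodule vG : subrep generated_act) \in
    inv_pred I (V := subrep generated_act).
  by apply/asboolP => g Jg; apply: val_inj; rewrite /= inv_act.
by exists (Invariants vI); apply: val_inj.
Qed.

Lemma generated_incl_weak_equiv : I_weak_equiv I generated_incl.
Proof.
have inclI : injective (Umap I generated_incl).
  by move=> x y exy; do 2!apply: val_inj; exact: (congr1 val exy).
apply: trivial_fibration_weak_equiv.
exists (invariants I (zeroRep k G)), (Umap I (hom_zero _ _)).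
have Z0 : is_zero (invariants I (zeroRep k G)).
  by move=> x; apply: val_inj; exact: thinmx0.
split; last exact: zero_fin_proj_dim.
split; last exact: generated_incl_surjective_U.
  by move=> x y _; rewrite [x]Z0 [y]Z0.
move=> y; split=> [y0|[x <-]]; last by rewrite [x]Z0 !raddf0.
by exists 0; apply: inclI; rewrite y0 !raddf0.
Qed.

Lemma cofibrant_generated : I_cofibrant I V -> generated_by_invariants I V.
Proof.
move=> /I_cofibrantP lift v.
have [h hv] := lift _ _ generated_incl (hom_id V)
  generated_incl_surjective_U generated_incl_weak_equiv.
have /asboolP := sub_valP (h v).
by rewrite -[sub_val _]/(generated_incl (h v)) hv.
Qed.

End GeneratedSubrepresentation.

(** A section s of the projection gives the isomorphism (w, v) |-> i w + s v
from the split extension. *)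
Lemma yoneda_splitP V W (E : P_extension I V W) :
  yoneda_equiv E (split_extension I V W) <->
  exists s : repHom V (ext_mid E), forall v, ext_proj E (s v) = v.
Proof.
have [[iI iq qS] _] := ext_exact E.
split=> [[f [[g fK gK] fi qf]]|[s sK]].
  have [||h [fh hf]] := @repHom_inverse k G _ _ f.
  - exact: can_inj fK.
  - by move=> y; exists (g y).
  by exists (hom_comp h (sum_inr W V)) => v; rewrite -qf hf.
pose t : repHom (sumRep W V) (ext_mid E) :=
  sum_hom (ext_inj E) s.
have [||h [th ht]] := @repHom_inverse k G _ _ t.
- apply: raddf_inj => -[w v] /= wv0.
  have v0 : v = 0.
    have := congr1 (ext_proj E) wv0; rewrite !raddfD raddf0 /= sK.
    by have -> : ext_proj E (ext_inj E w) = 0;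
      [apply/iq; exists w|rewrite add0r].
  move: wv0; rewrite v0 raddf0 addr0 => /eqP.
  by rewrite raddf_eq0 // => /eqP ->.
- move=> y; have [w wy] : exists w, ext_inj E w = y - s (ext_proj E y).
    by apply/iq; rewrite raddfB /= sK subrr.
  by exists (w, ext_proj E y); rewrite /= wy subrK.
exists h; split; first by exists t.
  by move=> w; rewrite -[RHS]th /= raddf0 addr0.
move=> x; rewrite -[in RHS](ht x) /= raddfD /= sK.
by have -> : ext_proj E (ext_inj E (h x).1) = 0;
  [apply/iq; exists (h x).1|rewrite add0r].
Qed.

Lemma cofibrant_Ext1_zero V : I_cofibrant I V ->
  forall W, fin_I_proj_dim I W -> Ext1_P_zero I V W.
Proof.
move=> /I_cofibrantP lift W /fin_I_proj_dim_U fpdW E.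
have [_ UE] := ext_exact E; have [_ _ UqS] := UE.
apply/yoneda_splitP; apply: (lift _ _ (ext_proj E) (hom_id V)) => //.
apply: trivial_fibration_weak_equiv.
by exists (invariants I W), (Umap I (ext_inj E)).
Qed.

(** U q hits the v-images of all invariant vectors, which generate the image
of v. *)
Lemma generated_image A B V (q : repHom A B) (v : repHom V B) :
  generated_by_invariants I V -> surjective (Umap I q) ->
  forall x, exists a, q a = v x.
Proof.
move=> genV UqS x; have [s ->] := genV x.
elim: s => [|t s [a qa]]; first by exists 0; rewrite big_nil !raddf0.
have [b /(congr1 val) /= qb] := UqS (Umap I v t.2).
exists (t.1.1 *: act t.1.2 (b : A) + a).
by rewrite big_cons !linearP /= qa !hom_act qb.
Qed.

Lemma generated_Ext1_zero_cofibrant V : generated_by_invariants I V ->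
  (forall W, fin_I_proj_dim I W -> Ext1_P_zero I V W) -> I_cofibrant I V.
Proof.
move=> genV extV; apply/I_cofibrantP => A B q v UqS wq.
have imv := generated_image v genV UqS.
have [kI kq] := ker_short_exact q.
have fpdK : fin_I_proj_dim I (ker_rep q).
  apply/fin_I_proj_dim_U; have [UkI Ukq] := U_left_exact kI kq.
  exact: (weak_equiv_kernel wq (And3 UkI Ukq UqS)).
(* The pullback of q and v is the kernel of (a, y) |-> q a - v y. *)
pose diff : repHom (sumRep A V) B :=
  sum_hom q (hom_comp (endN (hom_id B)) v).
pose prA : repHom (ker_rep diff) A := hom_comp (sum_fst A V) (ker_incl diff).
pose prV : repHom (ker_rep diff) V := hom_comp (sum_snd A V) (ker_incl diff).
have pb x : q (prA x) = v (prV x).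
  by apply/eqP; rewrite -subr_eq0; exact: (sub_valP x).
have pbI a y : q a = v y -> exists x, prA x = a /\ prV x = y.
  move=> qa; have xP : ((a, y) : sumRep A V) \in ker_pred diff.
    by rewrite [_ \in _]subr_eq0; apply/eqP.
  by exists (Submodule xP).
have prI x y : prA x = prA y -> prV x = prV y -> x = y.
  move=> xyA xyV; apply: val_inj.
  by rewrite [LHS]surjective_pairing [RHS]surjective_pairing; congr pair.
have inj0 x : diff (sum_inl A V (ker_incl q x)) = 0.
  by rewrite /= (eqP (sub_valP x)) raddf0 oppr0 addr0.
pose inj := @ker_lift _ _ _ _ _ diff
  (hom_comp (sum_inl A V) (ker_incl q)) inj0.
have injI : injective inj.
  by move=> x y /(congr1 prA); exact: val_inj.
have inj_prV : exact_at inj prV.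
  move=> x; split=> [xV|[y <-]] //.
  have qx : prA x \in ker_pred q by apply/eqP; rewrite [LHS]pb xV raddf0.
  by exists (Submodule qx); apply: prI.
have prVS : surjective prV.
  by move=> y; have [a /pbI[x [_ <-]]] := imv y; exists x.
have [UinjI Uinj_prV] := U_left_exact injI inj_prV.
have UprVS : surjective (Umap I prV).
  move=> y; have [a /(congr1 val) qa] := UqS (Umap I v y).
  have [x [xa xy]] := pbI _ _ qa.
  have xI : x \in inv_pred I (V := ker_rep diff).
    by apply/asboolP => g Jg; apply: prI; rewrite hom_act ?xa ?xy inv_act.
  by exists (Invariants xI); apply: val_inj.
pose E := PExtension (conj (And3 injI inj_prV prVS)
  (And3 UinjI Uinj_prV UprVS)).
have /yoneda_splitP[s sK] := extV _ fpdK E.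
by exists (hom_comp prA s) => y; rewrite [LHS]pb [prV _]sK.
Qed.

End CofibrantObjects.

Theorem lemma4p17 (k : fieldType) (p : nat) (char_k : p \in [pchar k])
    (G : topologicalGroupType) (I : open_pro_p_subgroup G p)
    (H_gorenstein : gorenstein (hecke k I)) (V : smoothRep k G) :
  I_cofibrant I V <->
  generated_by_invariants I V /\
  (forall W : smoothRep k G, fin_I_proj_dim I W -> Ext1_P_zero I V W).
Proof.
split=> [cofV|[genV extV]].
  by split; [exact: cofibrant_generated|exact: cofibrant_Ext1_zero].
exact: generated_Ext1_zero_cofibrant.
Qed.
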